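(* For all integers $1 \le p \le q$, \[ \mathsf{bc}(G_{p,q}) = \begin{cases} \frac{pq}{2} - 1, & \text{if $p$ is even and $q-1 = k(p-1) + 2\ell$ for some integers $0 \le \ell < k$;}\\[4pt] \left\lfloor \frac{pq}{2} \right\rfloor, & \text{otherwise.} \end{cases} \]
   Context: For integers $p,q\ge 1$, the grid graph $G_{p,q}$ has vertex set $[q]\times[p]$, where $(a,b)$ is adjacent to $(a',b')$ if and only if $|a-a'|+|b-b'|=1$. A biclique of a graph $G$ is a complete bipartite subgraph of $G$. The biclique covering number $\mathsf{bc}(G)$ is the minimum number of bicliques of $G$ whose union contains every edge of $G$. *)

(* Defs.v *)
From mathcomp Require Import all_boot ssrint.

Set Implicit Arguments.
Unset Strict Implicit.
Unset Printing Implicit Defensive.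

Import IntDist.

Record sgraph := SGraph {
  vertex :> finType;
  adj : rel vertex;
  adj_sym : symmetric adj;
  adj_irrefl : irreflexive adj
}.

Section Biclique.
Variable G : sgraph.

(* A complete bipartite subgraph is given by its two sides; its edges are all
   the pairs with one endpoint in each side.  The pairs (A, B) and (B, A) denote
   the same subgraph, which is harmless for a minimum number of bicliques. *)
Definition is_biclique (K : {set G} * {set G}) : bool :=
  [&& K.1 != set0, K.2 != set0, [disjoint K.1 & K.2] &
      [forall u in K.1, forall v in K.2, adj u v]].

Definition biclique_edge (K : {set G} * {set G}) (u v : G) : bool :=
  (u \in K.1) && (v \in K.2) || (v \in K.1) && (u \in K.2).

Definition is_biclique_cover (C : {set {set G} * {set G}}) : bool :=
  [forall K in C, is_biclique K] &&
  [forall u, forall v, adj u v ==> [exists K in C, biclique_edge K u v]].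

(* [arg min] is meaningful because the set of all bicliques is a cover: see
   all_bicliques_cover and bcP below. *)
Definition bc : nat :=
  #|[arg min_(C < [set K | is_biclique K] | is_biclique_cover C) #|C|]|.

Lemma all_bicliques_cover : is_biclique_cover [set K | is_biclique K].
Proof.
apply/andP; split; first by apply/forall_inP => K; rewrite inE.
apply/forallP => u; apply/forallP => v; apply/implyP => uv.
apply/existsP; exists ([set u], [set v]).
rewrite in_set /biclique_edge /= !set11 /= andbT.
apply/and4P; split.
- by apply/set0Pn; exists u; rewrite set11.
- by apply/set0Pn; exists v; rewrite set11.
- by rewrite disjoints1 inE; apply: contraTneq uv => ->; rewrite adj_irrefl.
- by apply/forall_inP => x /set1P ->; apply/forall_inP => y /set1P ->.
Qed.

Lemma bcP :
  (exists2 C, is_biclique_cover C & #|C| = bc) /\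
  (forall C, is_biclique_cover C -> bc <= #|C|).
Proof.
rewrite /bc; case: arg_minnP => [|C CC Cmin]; first exact: all_bicliques_cover.
by split; [exists C | exact: Cmin].
Qed.

End Biclique.

Section Grid.
Variables p q : nat.

Definition grid_adj (u v : 'I_q * 'I_p) : bool :=
  `|u.1 - v.1| + `|u.2 - v.2| == 1.

Lemma grid_adj_sym : symmetric grid_adj.
Proof. by move=> u v; rewrite /grid_adj distnC (distnC u.2). Qed.

Lemma grid_adj_irrefl : irreflexive grid_adj.
Proof. by move=> u; rewrite /grid_adj !distnn. Qed.

(* Coordinates are numbered from 0 instead of 1. *)
Definition grid : sgraph := SGraph grid_adj_sym grid_adj_irrefl.

End Grid.

Definition exceptional (p q : nat) : Prop :=
  ~~ odd p /\ exists k l : nat, l < k /\ q - 1 = k * (p - 1) + 2 * l.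

(* Main.v *)
Require Import Defs.
From mathcomp Require Import all_boot ssrint zify.

(* A biclique of the grid is a star or lies in a unit square, so a cover amounts
   to a set S of star centers and a set F of unit squares covering all edges
   outside S; let I be the complement of S.  Trading squares for vertices, every
   square of F may be assumed to have its four corners in I.  Call a horizontal
   edge defective if it has both ends in S or lies in two squares of F.  Counting
   horizontal edges bounds 4 (|I| - |F|) in terms of the first and last columns
   and of the number of defects, and a column contributes more only if it has
   several full edges (vertical edges with both ends in I).  Two full edges of
   the first column emit diagonal rays of vertices of I that meet, which forces a
   defect near that column; as p <= q these defects are not needed for the last
   column.  Hence |S| + |F| >= pq/2 - 1, and at least (pq - 1)/2 if p is odd.
   If pq/2 - 1 is attained, there is no defect and the first column alternates
   between S and I except for one full edge.  The evolution from column to column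
   is then forced: after p - 1 columns the pattern reappears upside down,
   possibly after a rest of two columns, and it must end exactly at the last
   column, which gives q - 1 = k(p - 1) + 2 l with l < k.  Conversely such k, l
   describe a zigzag path of squares from corner to corner, resting l times. *)

Set Implicit Arguments.
Unset Strict Implicit.
Unset Printing Implicit Defensive.

(** * Defects and rays *)

(** The value [false] at the border replaces a predecessor that truncation would send back to 0. *)
Definition leftF (F : nat -> nat -> bool) c j :=
  if c is c'.+1 then F c' j else false.
Definition belowF (F : nat -> nat -> bool) c j :=
  if j is j'.+1 then F c j' else false.

(* [I c j]: the vertex in column [c <= n] and row [j < p] is not a star center;
   [F c j]: the unit square with lower left corner [(c, j)] is used. *)
Definition valid (n p : nat) (I F : nat -> nat -> bool) : Prop :=
  [/\ forall c j, F c j -> c < n /\ j.+1 < p,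
      forall c j, F c j -> [/\ I c j, I c j.+1, I c.+1 j & I c.+1 j.+1],
      forall c j, c <= n -> j.+1 < p -> I c j -> I c j.+1 -> F c j || leftF F c j
    & forall c j, c < n -> j < p -> I c j -> I c.+1 j -> F c j || belowF F c j].

Definition defect (I F : nat -> nat -> bool) c j :=
  ~~ (I c j || I c.+1 j) || (F c j && belowF F c j).

(** No square covers the edge above [(c, j)] from the left, so if its upper end is in [I] too, the
    square on its right must be used. [down] is the same for the edge below. *)
Definition up (I F : nat -> nat -> bool) c j := I c j && ~~ leftF F c j.
Definition down (I F : nat -> nat -> bool) c j :=
  I c j && ~~ (if c is c'.+1 then belowF F c' j else false).

Lemma defect_balance n p I F c j : valid n p I F -> c < n -> j < p ->
  I c j + I c.+1 j + defect I F c j = 1 + F c j + belowF F c j.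
Proof.
case=> _ sqI _ hor cn jp; have := hor _ _ cn jp; rewrite /defect.
have := sqI c j; have : belowF F c j -> I c j /\ I c.+1 j.
  by case: (j) => //= j' /sqI [].
case: (belowF F c j) => [/(_ isT) [-> ->]|_]; case: (F c j) => //=.
- by move=> /(_ isT) [-> _ -> _].
- by case: (I c j); case: (I c.+1 j) => //= _ /(_ isT isT).
Qed.

(** If [(c, j.+1)] is in [I], the edge below it needs the square on its right, which has
    [(c.+1, j.+1)] as a corner; a second square on top of it would be a defect. Otherwise
    [(c, j.+1)] is a center: its right neighbor is in [I] for lack of a defect, and no square has a
    center as corner. *)
Lemma up_step n p I F c j : valid n p I F -> c < n -> j.+1 < p ->
  ~~ defect I F c j.+1 -> up I F c j -> up I F c.+1 j.+1.
Proof.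
case=> _ sqI ver _ cn jp; rewrite /defect negb_or negbK /up /=.
move=> /andP [ss dd] /andP [Icj lF].
case Ij: (I c j.+1).
  have := ver _ _ (ltnW cn) jp Icj Ij; rewrite (negbTE lF) orbF => Fcj.
  have [_ _ _ ->] := sqI _ _ Fcj; move: dd; rewrite Fcj andbT => /negbTE ->.
  by [].
move: ss; rewrite Ij /= => -> /=; apply/negP => /sqI [].
by rewrite Ij.
Qed.

Lemma down_step n p I F c j : valid n p I F -> c < n -> j.+1 < p ->
  ~~ defect I F c j -> down I F c j.+1 -> down I F c.+1 j.
Proof.
case=> _ sqI ver _ cn jp; rewrite /defect negb_or negbK /down.
move=> /andP [ss dd] /andP [Icj lF].
have {}lF : ~~ leftF F c j by case: (c) lF.
case Ij: (I c j).
  have := ver _ _ (ltnW cn) jp Ij Icj; rewrite (negbTE lF) orbF => Fcj.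
  by have [_ _ -> _] := sqI _ _ Fcj; move: dd; rewrite Fcj.
move: ss; rewrite Ij /= => -> /=; apply/negP; case: (j) Ij => //= j' Ij /sqI [].
by rewrite Ij.
Qed.

Lemma up_ray n p I F c j k : valid n p I F -> c + k <= n -> j + k < p ->
  (forall i, i < k -> ~~ defect I F (c + i) (j + i).+1) ->
  up I F c j -> up I F (c + k) (j + k).
Proof.
move=> V; elim: k => [|k IH] ck jk nd; first by rewrite !addn0.
move=> u; rewrite !addnS; apply: (up_step V); [lia | lia | exact: nd |].
by apply: IH => //; [lia | lia | move=> i ik; apply: nd; lia].
Qed.

Lemma down_ray n p I F c j k : valid n p I F -> c + k <= n -> j + k < p ->
  (forall i, i < k -> ~~ defect I F (c + i) (j + k - i).-1) ->
  down I F c (j + k) -> down I F (c + k) j.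
Proof.
move=> V; elim: k c => [|k IH] c ck jk nd; first by rewrite !addn0.
rewrite addnS => d; rewrite addnS -addSn; apply: IH; [lia | lia | |].
  move=> i ik; have := nd i.+1; rewrite addnS addSn.
  by rewrite (_ : j + k.+1 - i.+1 = j + k - i); [apply; lia | lia].
apply: (down_step V) => //; [lia | lia |].
by have := nd 0 isT; rewrite addn0 subn0 addnS.
Qed.

(* The rays going up from the lower edge and down from the upper edge meet at
   a vertex both of whose vertical edges still have to be covered. *)
Lemma two_full_edges n p I F u v : valid n p I F -> u < v -> v.+1 < p ->
    v - u <= n.*2 ->
    I 0 u -> I 0 u.+1 -> I 0 v -> I 0 v.+1 ->
    (forall c r, u < r <= v -> c.*2 < v - u -> ~~ defect I F c r) -> False.
Proof.
move=> V uv vp vn Iu Iu1 Iv Iv1 nd.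
(* The rays travel through [m] columns; the parity [o] tells which end of the upper edge sends its
   ray to row [u + m + 2]. *)
have [m [o mE]] : exists m (o : bool), v = u.+1 + m.*2 + o.
  exists (v - u.+1)./2, (odd (v - u.+1)).
  by have := odd_double_half (v - u.+1); lia.
have up0 j : I 0 j -> up I F 0 j by rewrite /up => ->.
have dn0 j : I 0 j -> down I F 0 j by rewrite /down => ->.
have [mn mp mv] : [/\ m < n, (u + m).+2 < p & (u + m).+1 <= v /\ m.*2 < v - u].
  by clear -vp vn uv mE; split; case: o mE => /=; lia.
have U0 : up I F m (u + m).
  rewrite -[X in up _ _ X]add0n; apply: (up_ray V); [lia | lia | |exact: up0].
  by move=> i im; apply: nd; lia.
have U1 : up I F m (u.+1 + m).
  rewrite -[X in up _ _ X]add0n; apply: (up_ray V); [lia | lia | |exact: up0].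
  by move=> i im; apply: nd; lia.
have D : down I F m (u.+2 + m).
  rewrite -[X in down _ _ X]add0n; apply: (down_ray V); [lia | lia | |].
    by move=> i im; apply: nd; lia.
  apply: dn0; case: o mE => mE.
    by rewrite (_ : u.+2 + m + m = v) //; lia.
  by rewrite (_ : u.+2 + m + m = v.+1) //; lia.
case: V => _ _ ver _.
have /andP [I0 L0] := U0; have /andP [I1 L1] := U1; have /andP [I2 _] := D.
rewrite addSn in I1 L1; rewrite !addSn in I2.
have F0 : F m (u + m).
  by have := ver m (u + m) (ltnW mn) (ltnW mp) I0 I1; rewrite (negbTE L0) orbF.
have F1 : F m (u + m).+1.
  by have := ver m (u + m).+1 (ltnW mn) mp I1 I2; rewrite (negbTE L1) orbF.
have /negP := nd m (u + m).+1 (introT andP (conj (leq_addr _ _) mv.1)) mv.2.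
by apply; rewrite /defect /= F0 F1 orbT.
Qed.

(** * Counting *)

(** On each edge of a path, the number of marked ends, plus one if there is none, is 1, plus one if
    both are marked. Summing counts inner vertices twice and the two ends once. *)
Lemma alternation_sum p (b : nat -> bool) :
  2 * \sum_(j < p.+1) b j + \sum_(j < p) ~~ (b j || b j.+1) =
  p + \sum_(j < p) (b j && b j.+1) + b 0 + b p.
Proof.
elim: p => [|p IH]; first by rewrite !big_ord0 big_ord_recr big_ord0 /=; lia.
rewrite big_ord_recr /= (big_ord_recr p (fun j => nat_of_bool (~~ _))) /=.
rewrite (big_ord_recr p (fun j => nat_of_bool (_ && _))) /=.
by case: (b p) IH; case: (b p.+1) => /=; lia.
Qed.

(** The same double count, with columns in place of vertices. *)
Lemma adjacent_sum n p (f d g : nat -> nat) :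
  (forall c, c < n -> f c + f c.+1 + d c = p + 2 * g c) ->
  2 * (\sum_(c < n.+1) f c) + \sum_(c < n) d c =
  n * p + f 0 + f n + 2 * \sum_(c < n) g c.
Proof.
elim: n => [|n IH] strip; first by rewrite big_ord_recr !big_ord0 /=; lia.
have := IH (fun c cn => strip c (ltnW cn)); have := strip n (ltnSn n).
by rewrite !(big_ord_recr n.+1) !(big_ord_recr n) /=; lia.
Qed.

Lemma horizontal_sum n p I F : valid n p I F ->
  2 * (\sum_(c < n.+1) \sum_(j < p) I c j) + \sum_(c < n) \sum_(j < p) defect I F c j =
  n * p + \sum_(j < p) I 0 j + \sum_(j < p) I n j + 2 * \sum_(c < n) \sum_(j < p) F c j.
Proof.
move=> V.
have below c : \sum_(j < p) belowF F c j = \sum_(j < p) F c j.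
  case: p V => [|p] V; first by rewrite !big_ord0.
  rewrite big_ord_recl [RHS]big_ord_recr /= add0n.
  have -> : F c p = false by apply/negP => /(let: And4 s _ _ _ := V in s) []; lia.
  by rewrite addn0; apply: eq_bigr.
have strip c : c < n ->
    \sum_(j < p) I c j + \sum_(j < p) I c.+1 j + \sum_(j < p) defect I F c j =
    p + 2 * \sum_(j < p) F c j.
  move=> cn; transitivity (\sum_(j < p) (1 + F c j + belowF F c j)).
    by rewrite -!big_split /=; apply: eq_bigr => j _; rewrite (defect_balance V).
  by rewrite !big_split /= below sum1_card card_ord mul2n -addnn addnA.
exact: (adjacent_sum (f := fun c => \sum_(j < p) I c j)
  (d := fun c => \sum_(j < p) defect I F c j) (g := fun c => \sum_(j < p) F c j)).
Qed.

Definition full_edges p (b : nat -> bool) := \sum_(j < p.-1) (b j && b j.+1).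

(** By [two_full_edges], a defect lies in the rows between consecutive full edges, so different
    pairs give different defects. Since [v - u] is at most [p - 2], only strips with [c.*2 + 2 < p]
    matter. *)
Lemma full_edges_bound n p I F : valid n p I F -> p <= n.+1 ->
  full_edges p (I 0) <= 1 + \sum_(c < n | c.*2 + 2 < p) \sum_(j < p) defect I F c j.
Proof.
move=> V pn; rewrite exchange_big /=.
pose D r := \sum_(c < n | c.*2 + 2 < p) defect I F c r.
rewrite -/(\sum_(j < p) D j).
(* Scanning the rows upwards, [u] is the latest full edge; only the defects in rows up to [u] have
   been charged. *)
suff H m : m <= p.-1 -> (forall u, u < m -> ~~ (I 0 u && I 0 u.+1)) \/
    (exists2 u, u < m & I 0 u && I 0 u.+1 /\
       \sum_(j < m) (I 0 j && I 0 j.+1) <= 1 + \sum_(j < u.+1) D j).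
  rewrite /full_edges; have [none | [u um [_ le]]] := H _ (leqnn _).
    by rewrite big1 // => j _; rewrite (negbTE (none _ _)).
  apply: leq_trans le _; rewrite leq_add2l.
  rewrite (big_ord_widen p D); last by lia.
  by rewrite [leqRHS](bigID (fun j : 'I_p => j < u.+1)) leq_addr.
elim: m => [|m IH] mp; first by left.
case E : (I 0 m && I 0 m.+1); last first.
  case: (IH (ltnW mp)) => [none | [u um [Iu le]]].
    left=> u; rewrite ltnS leq_eqVlt => /orP [/eqP -> | /none //].
    by rewrite E.
  by right; exists u; [exact: ltnW | split=> //; rewrite big_ord_recr /= E addn0].
right; exists m => //; split=> //; rewrite big_ord_recr /= E.
case: (IH (ltnW mp)) => [none | [u um [Iu le]]].
  rewrite big1 => [|j _]; first by rewrite add0n leq_addr.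
  by rewrite (negbTE (none _ _)).
suff pos : 0 < \sum_(u.+1 <= j < m.+1) D j.
  rewrite -(big_mkord predT D) (big_cat_nat (n := u.+1)) //=; last exact: ltnW.
  rewrite addnA; apply: leq_add => //; by rewrite (big_mkord predT D).
rewrite lt0n; apply/negP => /eqP /eqP; rewrite sum_nat_seq_eq0 => /allP zero.
have mp2 : m.+1 < p by lia.
apply: (two_full_edges V um mp2 _ (proj1 (andP Iu)) (proj2 (andP Iu))
  (proj1 (andP E)) (proj2 (andP E))); first by lia.
move=> c r umr cm; have := zero r; rewrite mem_index_iota ltnS umr => /(_ isT) /=.
have cn : c < n by lia.
rewrite sum_nat_eq0 => /forallP /(_ (Ordinal cn)) /implyP /=.
by rewrite eqb0; apply; lia.
Qed.

Definition mirror_I n (I : nat -> nat -> bool) c j := I (n - c) j.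
(** Strip [c] goes to strip [n.-1 - c]; the guard keeps truncated subtraction from creating squares
    beyond the last column. *)
Definition mirror_F n (F : nat -> nat -> bool) c j := (c < n) && F (n.-1 - c) j.

Lemma mirror_valid n p I F : valid n p I F -> valid n p (mirror_I n I) (mirror_F n F).
Proof.
case=> dom sqI ver hor; split; rewrite /mirror_I /mirror_F => c j.
- by case/andP=> cn /dom [_ jp].
- case/andP=> cn /sqI; rewrite (_ : n - c = (n.-1 - c).+1); last by lia.
  by rewrite (_ : n - c.+1 = n.-1 - c); [case=> *; split | lia].
- move=> cn jp I1 I2; have := ver _ _ (leq_subr c n) jp I1 I2.
  case: c {I1 I2} cn => [|c] cn /=.
    case: n dom {sqI ver hor} cn => [|n] dom _; rewrite /= ?subn0 => /orP [/dom [] | //].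
    - by [].
    - by rewrite ltnn.
    - by rewrite orbF.
  rewrite cn /= subnS orbC; case E: (n - c).-1 => [|m] /=.
    by rewrite (_ : n.-1 - c = 0); [move=> ->; rewrite orbT | lia].
  rewrite (_ : n.-1 - c = m.+1); last by lia.
  rewrite (_ : n.-1 - c.+1 = m); last by lia.
  by rewrite (_ : c.+1 < n); [case/orP=> ->; rewrite ?orbT | lia].
- move=> cn jp I1 I2; rewrite cn /=.
  have -> : belowF (mirror_F n F) c j = belowF F (n.-1 - c) j.
    by case: (j) => //= j'; rewrite /mirror_F cn.
  apply: hor => //; first by lia.
    by rewrite (_ : n.-1 - c = n - c.+1) //; lia.
  by rewrite (_ : (n.-1 - c).+1 = n - c) //; lia.
Qed.

Lemma mirror_defect n I F c j : c < n ->
  defect (mirror_I n I) (mirror_F n F) c j = defect I F (n.-1 - c) j.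
Proof.
move=> cn; rewrite /defect /mirror_I.
rewrite (_ : (n.-1 - c).+1 = n - c); last by lia.
rewrite (_ : n - c.+1 = n.-1 - c); last by lia.
rewrite [I (n - c) j || _]orbC /mirror_F cn.
by case: (j) => //= j'; rewrite cn.
Qed.

Lemma full_edges_bound_right n p I F : valid n p I F -> p <= n.+1 ->
  full_edges p (I n) <=
  1 + \sum_(c < n | (n - c.+1).*2 + 2 < p) \sum_(j < p) defect I F c j.
Proof.
move=> V pn; have := full_edges_bound (mirror_valid V) pn.
rewrite {1}/mirror_I subn0 (reindex_inj rev_ord_inj) /=.
rewrite (eq_bigr (fun c : 'I_n => \sum_(j < p) defect I F c j)) //.
move=> c _; apply: eq_bigr => j _; have cn := ltn_ord c.
rewrite mirror_defect /=; last by lia.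
by congr (nat_of_bool (defect I F _ j)); lia.
Qed.

(* As [p <= n.+1], no strip is counted on both sides. *)
Lemma full_edges_bounds n p I F : valid n p I F -> p <= n.+1 ->
  [/\ full_edges p (I 0) <= 1 + \sum_(c < n) \sum_(j < p) defect I F c j,
      full_edges p (I n) <= 1 + \sum_(c < n) \sum_(j < p) defect I F c j &
      full_edges p (I 0) + full_edges p (I n) <=
      2 + \sum_(c < n) \sum_(j < p) defect I F c j].
Proof.
move=> V pn; have L := full_edges_bound V pn; have R := full_edges_bound_right V pn.
split.
- apply: leq_trans L _; rewrite leq_add2l.
  by rewrite [leqRHS](bigID (fun c : 'I_n => c.*2 + 2 < p)) leq_addr.
- apply: leq_trans R _; rewrite leq_add2l.
  by rewrite [leqRHS](bigID (fun c : 'I_n => (n - c.+1).*2 + 2 < p)) leq_addr.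
apply: leq_trans (leq_add L R) _.
rewrite addnACA leq_add2l [leqRHS](bigID (fun c : 'I_n => c.*2 + 2 < p)) /= leq_add2l.
rewrite [leqRHS](bigID (fun c : 'I_n => (n - c.+1).*2 + 2 < p)) /=.
rewrite [X in X <= _](_ : _ = \sum_(i < n | ~~ (i.*2 + 2 < p) && ((n - i.+1).*2 + 2 < p))
   \sum_(j < p) defect I F i j) ?leq_addr //.
by apply: eq_bigl => c; case: c => c cn /=; lia.
Qed.

(** * Covers without defects *)

Definition flip_I p (I : nat -> nat -> bool) c j := I c (p.-1 - j).
(** Turning the grid upside down swaps the squares above and below a horizontal edge; a square's
    lower row [j] becomes [p.-2 - j]. *)
Definition flip_F p (F : nat -> nat -> bool) c j := (j.+1 < p) && F c (p.-2 - j).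

Lemma flip_belowF p (F : nat -> nat -> bool) c j :
  (forall c j, F c j -> j.+1 < p) -> j < p ->
  belowF (flip_F p F) c j = F c (p.-1 - j).
Proof.
move=> dom; case: j => [|j] jp /=.
  by apply/esym/negP => /dom; lia.
by rewrite /flip_F jp /=; congr F; lia.
Qed.

Lemma flip_FE p F c j : j < p -> flip_F p F c j = belowF F c (p.-1 - j).
Proof.
move=> jp; rewrite /flip_F; case: ltnP => [j1p|pj] /=.
  by rewrite (_ : p.-1 - j = (p.-2 - j).+1) //; lia.
by rewrite (_ : p.-1 - j = 0) //; lia.
Qed.

Lemma flip_valid n p I F : valid n p I F -> valid n p (flip_I p I) (flip_F p F).
Proof.
case=> dom sqI ver hor; split; rewrite /flip_I => c j.
- by rewrite /flip_F => /andP [jp /dom []].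
- rewrite /flip_F => /andP [jp /sqI].
  rewrite (_ : (p.-2 - j).+1 = p.-1 - j); last by lia.
  by rewrite (_ : p.-2 - j = p.-1 - j.+1); [case=> *; split | lia].
- move=> cn jp I1 I2; have := ver c (p.-2 - j) cn.
  rewrite (_ : (p.-2 - j).+1 = p.-1 - j); last by lia.
  rewrite (_ : p.-2 - j = p.-1 - j.+1); last by lia.
  move=> /(_ _ I2 I1); rewrite {1}/flip_F jp /= (_ : p.-2 - j = p.-1 - j.+1); last by lia.
  move=> /(_ ltac:(lia)); case: (c) => //= c'; rewrite /flip_F jp /=.
  by rewrite (_ : p.-2 - j = p.-1 - j.+1); last by lia.
- move=> cn jp I1 I2; rewrite flip_FE // flip_belowF; last 2 first.
  + by move=> ? ? /dom [].
  + by [].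
  by rewrite orbC; apply: hor => //; lia.
Qed.

Lemma flip_defect n p I F c j : valid n p I F -> j < p ->
  defect (flip_I p I) (flip_F p F) c j = defect I F c (p.-1 - j).
Proof.
case=> dom _ _ _ jp; rewrite /defect /flip_I flip_FE // flip_belowF; last 2 first.
- by move=> ? ? /dom [].
- by [].
by rewrite [belowF _ _ _ && _]andbC.
Qed.

Definition defect_free n p I F :=
  forall c j, c < n -> j < p -> ~~ defect I F c j.

(* Column [c] alternates except for one full edge, between rows [a.-1] and [a]. *)
Definition block p a (I : nat -> nat -> bool) c :=
  forall j, j < p -> I c j = (if j < a then ~~ odd j else odd j).

Lemma flip_defect_free n p I F : valid n p I F -> defect_free n p I F ->
  defect_free n p (flip_I p I) (flip_F p F).
Proof. by move=> V nd c j cn jp; rewrite (flip_defect _ V) //; apply: nd => //; lia. Qed.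

Lemma flip_block p a I c : ~~ odd p -> a < p -> block p a I c -> block p (p - a) (flip_I p I) c.
Proof.
move=> ev ap B j jp; rewrite /flip_I B; last by lia.
by case: ifP; case: ifP; lia.
Qed.

Lemma defect_free_neighbor n p I F c j : valid n p I F -> defect_free n p I F ->
  c < n -> j < p -> ~~ F c j -> ~~ belowF F c j -> I c.+1 j = ~~ I c j.
Proof.
move=> V nd cn jp Fj Bj; have := defect_balance V cn jp.
by rewrite (negbTE Fj) (negbTE Bj) (negbTE (nd _ _ cn jp)); case: (I c j); case: (I _ j).
Qed.

Section Block.
Variables (n p a : nat) (I F : nat -> nat -> bool).
Hypotheses (evp : ~~ odd p) (odda : odd a) (ap : a < p).
Hypotheses (V : valid n p I F) (nd : defect_free n p I F) (B : block p a I 0).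

(** Below the full edge the column alternates, so it has no room for a square and the next column is
    its complement; the region loses one row per column. *)
Lemma block_triangle t j : t <= n -> t + j < a -> I t j = ~~ odd (t + j).
Proof.
elim: t j => [|t IH] j tn tja; first by rewrite B ?add0n; [case: ifP; lia | lia].
have [_ sqI _ _] := V.
rewrite (defect_free_neighbor V nd) //; first by rewrite IH //; lia.
- by lia.
- by apply/negP => /sqI [I1 I2 _ _]; rewrite !IH in I1 I2; lia.
- apply/negP; case: j tja => //= j tja /sqI [I1 I2 _ _].
  by rewrite !IH in I1 I2; lia.
Qed.

(** Rising rays fill a diagonal band: they start at the even rows below [a] of the first column, or
    on the bottom row inside the triangle of [block_triangle]. *)
Lemma block_up t j : t <= n -> j < p -> ~~ odd (t + j) -> j < t + a -> t < j + a ->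
  up I F t j.
Proof.
have [_ sqI _ _] := V.
elim: t j => [|t IH] j tn jp ev jta tja.
  by rewrite /up /= andbT block_triangle; lia.
case: j jp ev jta tja => [|j] jp ev jta tja.
  rewrite /up block_triangle ?ev //=; last by lia.
  apply/negP => /sqI [I1 I2 _ _]; rewrite !block_triangle in I1 I2; lia.
apply: (up_step V) => //; first by apply: nd; lia.
by apply: IH; lia.
Qed.

End Block.

Section Traverse.
Variables (n p a : nat) (I F : nat -> nat -> bool).
Hypotheses (evp : ~~ odd p) (odda : odd a) (ap : a < p).
Hypotheses (V : valid n p I F) (nd : defect_free n p I F) (B : block p a I 0).

(** This is [block_up] upside down, where [a] becomes [p - a]. *)
Lemma block_down t j : t <= n -> j < p -> odd (t + j) -> a <= t + j -> t + j + a < p.*2.-1 ->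
  down I F t j.
Proof.
move=> tn jp od a1 a2; have [dom _ _ _] := V.
have := block_up _ _ _ (flip_valid V) (flip_defect_free V nd) (flip_block evp ap B) tn.
have oda : odd (p - a) by lia.
move=> /(_ evp oda ltac:(lia) (p.-1 - j)); rewrite /up /down /flip_I (_ : p.-1 - (p.-1 - j) = j); last by lia.
move=> H; have {H} /andP [-> /=] : I t j && ~~ leftF (flip_F p F) t (p.-1 - j).
  by apply: H; lia.
case: (t) => //= t'; rewrite flip_FE; last by lia.
by rewrite (_ : p.-1 - (p.-1 - j) = j) //; lia.
Qed.

(** Vertices of even sum lie on rising rays. One of odd sum has its left neighbor in [I], and no
    square contains the edge between them, so it is a center. *)
Lemma block_upper t j : t <= n -> t < p -> j < p -> p.*2 <= t + j + a.+1 ->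
  I t j = ~~ odd (t + j).
Proof.
have [_ sqI ver _] := V.
elim: t j => [|t IH] j tn tp jp le; first by lia.
case od: (odd (t.+1 + j)); last first.
  have U : up I F t.+1 j by apply: (block_up evp odda ap V nd B) => //; lia.
  by case/andP: U => ->.
have It : I t j by rewrite IH; lia.
rewrite (defect_free_neighbor V nd) //= ?It //.
- have [dom _ _ _] := V; apply/negP => Fj; have [_ j1p] := dom _ _ Fj.
  by have [_ I2 _ _] := sqI _ _ Fj; rewrite IH in I2; lia.
- case: j od le It jp => //= j od le It jp; apply/negP => Fj.
  have [I1 _ _ _] := sqI _ _ Fj.
  (* On the border of the region a falling ray meets a rising one, which forces the square below
     [F t j] as well: a defect. *)
  case: (ltnP (t + j + a.+1) p.*2) => [lt|le2]; last by rewrite IH in I1; lia.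
  have D : down I F t j by apply: block_down; lia.
  case: j od le It jp Fj I1 lt D => [|j] od le It jp Fj I1 lt D; first by lia.
  have U : up I F t j by apply: (block_up evp odda ap V nd B); lia.
  have Fj0 : F t j.
    case/andP: U => I0 L; have := ver t j (ltnW tn) ltac:(lia) I0 I1.
    by rewrite (negbTE L) orbF.
  have := nd (c := t) (j := j.+1) tn ltac:(lia).
  by rewrite /defect /= Fj Fj0 orbT.
Qed.

(** Otherwise a rising and a falling ray hit vertically adjacent vertices of the last column, whose
    edge has no square on its right. *)
Lemma block_reach : p.-1 <= n.
Proof.
have [dom _ ver _] := V; rewrite leqNgt; apply/negP => np.
have [j [[jE j1p] [ja na] [an le]]] : exists j, [/\ ~~ odd (n + j) /\ j.+1 < p,
    j < n + a /\ n < j + a & a <= n + j.+1 /\ n + j.+1 + a < p.*2.-1].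
  (* The first choice of [j] uses the lowest falling ray, the second the lowest rising ray. *)
  case: (ltnP n a) => na; first by exists (a.-1 - n); split; split; lia.
  by exists (n - a.-1); split; split; lia.
have U : up I F n j by apply: (block_up evp odda ap V nd B); lia.
have D : down I F n j.+1 by apply: block_down; lia.
case/andP: U => I0 L; case/andP: D => I1 _.
by have := ver n j (leqnn _) j1p I0 I1; rewrite (negbTE L) orbF => /dom; rewrite ltnn => -[].
Qed.

End Traverse.

Lemma block_traverse n p a I F : ~~ odd p -> odd a -> a < p ->
  valid n p I F -> defect_free n p I F -> block p a I 0 -> block p (p - a) I p.-1.
Proof.
move=> evp odda ap V nd B j jp.
have le := block_reach evp odda ap V nd B.
case: ifP => [lt|ge]; last by rewrite (block_upper evp odda ap V nd B) //; lia.
have oda : odd (p - a) by lia.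
have := block_upper evp oda _ (flip_valid V) (flip_defect_free V nd) (flip_block evp ap B).
move=> /(_ ltac:(lia) p.-1 (p.-1 - j) le); rewrite /flip_I.
rewrite (_ : p.-1 - (p.-1 - j) = j); last by lia.
by move=> -> //; lia.
Qed.

(** Cutting off [c] columns loses the squares to the left of column [c], so its full edges must be
    covered from the right. *)
Lemma shift_valid n p I F c : valid n p I F -> c <= n ->
  (forall j, j.+1 < p -> I c j -> I c j.+1 -> F c j) ->
  valid (n - c) p (fun t => I (c + t)) (fun t => F (c + t)).
Proof.
case=> dom sqI ver hor cn st; split=> t j.
- by case/dom => ? ?; split=> //; lia.
- by move/sqI; rewrite addnS.
- move=> tn jp; case: t tn => [|t] tn I1 I2 /=.
    by rewrite addn0 in I1 I2 *; rewrite st.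
  by have := ver _ _ _ jp I1 I2; rewrite addnS /=; apply; lia.
- move=> tn jp I1 I2; have := hor (c + t) j; rewrite -addnS => /(_ _ jp I1 I2) H.
  have {H} : F (c + t) j || belowF F (c + t) j by apply: H; lia.
  by case: (j).
Qed.

Lemma shift_defect_free n p I F c : defect_free n p I F -> c <= n ->
  defect_free (n - c) p (fun t => I (c + t)) (fun t => F (c + t)).
Proof.
move=> nd cn t j tn jp; have := nd (c + t) j ltac:(lia) jp.
by rewrite /defect addnS; case: (j).
Qed.

(** Induction on the width. After a traversal, either the full edge is covered from the right and
    the next traversal starts at once, or two columns are spent at rest first, which adds one to [l]
    as well as to [k]. *)
Lemma block_length n p a I F : ~~ odd p -> odd a -> a < p ->
  valid n p I F -> defect_free n p I F -> block p a I 0 -> I n 0 ->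
  exists k l, l < k /\ n = k * p.-1 + 2 * l.
Proof.
elim/ltn_ind: n a I F => n IH a I F evp odda ap V nd B In0.
have le := block_reach evp odda ap V nd B.
have B' := block_traverse evp odda ap V nd B.
have {a odda ap B B'} [a [odda ap B]] : exists a, [/\ odd a, a < p & block p a I p.-1].
  by exists (p - a); split=> //; lia.
case: (ltngtP n p.-1) => [||nE]; [lia | move=> lt | by exists 1, 0; lia].
have [dom sqI ver hor] := V.
have full c j : block p a I c -> j.+1 < p -> I c j -> I c j.+1 -> j = a.-1.
  by move=> Bc jp; rewrite !Bc //; [case: ifP; case: ifP; lia | lia].
have next c : c < n -> p.-1 <= c -> block p a I c -> F c a.-1 ->
    exists k l, l < k /\ n - c = k * p.-1 + 2 * l.
  move=> cn pc Bc Fc; have cn' := ltnW cn.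
  apply: (IH (n - c) _ a (fun t => I (c + t)) (fun t => F (c + t))) => //.
  - by lia.
  - by apply: shift_valid => // j jp I1 I2; rewrite (full _ _ Bc jp I1 I2).
  - exact: shift_defect_free.
  - by move=> j jp; rewrite addn0 Bc.
  - by rewrite subnKC.
case Fc: (F p.-1 a.-1).
  have [k [l [lk E]]] := next _ lt (leqnn _) B Fc.
  by exists k.+1, l; split; lia.
have F0 j : ~~ F p.-1 j.
  apply/negP => Fj; have [I1 I2 _ _] := sqI _ _ Fj; have [_ jp] := dom _ _ Fj.
  by rewrite (full _ _ B jp I1 I2) Fc in Fj.
have I1 j : j < p -> I p.-1.+1 j = ~~ I p.-1 j.
  by move=> jp; apply: (defect_free_neighbor V nd) => //; case: (j) => //= j'; apply: F0.
(* The complemented column has a center in row 0, so by [In0] it is not the last one. *)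
have lt1 : p.-1.+1 < n.
  rewrite ltn_neqAle lt andbT; apply/eqP => E; move: In0.
  by rewrite -E I1 ?B; [case: ifP; lia | lia | lia].
have F1 j : ~~ F p.-1.+1 j.
  apply/negP => Fj; have [J1 J2 _ _] := sqI _ _ Fj; have [_ jp] := dom _ _ Fj.
  rewrite !I1 ?B in J1 J2; [|lia..].
  have [_ _] := V; move: J1 J2; case: ifP; case: ifP => ? ? J1 J2 _ _; try lia.
have I2 j : j < p -> I p.-1.+2 j = I p.-1 j.
  move=> jp; rewrite -[RHS]negbK -I1 //; apply: (defect_free_neighbor V nd) => //.
  by case: (j) => //= j'; apply: F1.
have B2 : block p a I p.-1.+2 by move=> j jp; rewrite I2 // B.
have F2 : F p.-1.+2 a.-1.
  have := ver p.-1.+2 a.-1 lt1; rewrite /= (negbTE (F1 _)) orbF.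
  by apply; rewrite ?B2; [lia | case: ifP; lia | lia | case: ifP; lia | lia].
have [lt2 _] := dom _ _ F2.
have [k [l [lk E]]] := next _ lt2 ltac:(lia) B2 F2.
by exists k.+1, l.+1; split; lia.
Qed.

(** * The lower bound *)

Lemma alternating p (b : nat -> bool) : b 0 ->
  \sum_(j < p) ~~ (b j || b j.+1) = 0 -> \sum_(j < p) (b j && b j.+1) = 0 ->
  forall j, j <= p -> b j = ~~ odd j.
Proof.
move=> b0; elim: p => [|p IH]; first by move=> _ _ [].
rewrite !big_ord_recr /= => /eqP; rewrite addn_eq0 => /andP [/eqP s0 e0].
move=> /eqP; rewrite addn_eq0 => /andP [/eqP f0 e1] j.
rewrite leq_eqVlt => /orP [/eqP -> | ]; last by rewrite ltnS; apply: IH.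
move: e0 e1; rewrite (IH s0 f0 p (leqnn _)) /=.
by case: (odd p); case: (b p.+1).
Qed.

Lemma one_full_edge p (b : nat -> bool) : b 0 ->
  \sum_(j < p) ~~ (b j || b j.+1) = 0 -> \sum_(j < p) (b j && b j.+1) = 1 ->
  exists a, [/\ odd a, a <= p &
    forall j, j <= p -> b j = (if j < a then ~~ odd j else odd j)].
Proof.
move=> b0; elim: p => [|p IH]; first by rewrite !big_ord0.
rewrite !big_ord_recr /= => /eqP; rewrite addn_eq0 => /andP [/eqP s0 e0].
case e1: (b p && b p.+1) => e2.
  have f0 : \sum_(j < p) (b j && b j.+1) = 0 by apply/eqP; rewrite -(eqn_add2r 1) e2.
  have alt := alternating b0 s0 f0; case/andP: e1 => bp bp1.
  have ep : ~~ odd p by rewrite -(alt p).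
  exists p.+1; split=> // j; rewrite leq_eqVlt => /orP [/eqP -> | jp].
    by rewrite ltnn /= ep bp1.
  by rewrite jp alt.
have [a [oa ap ba]] := IH s0 (etrans (esym (addn0 _)) e2).
exists a; split=> //; first exact: leqW.
move=> j; rewrite leq_eqVlt => /orP [/eqP -> | ]; last by rewrite ltnS; apply: ba.
have := ba p (leqnn _); rewrite (leq_gtF ap) (leq_gtF (leqW ap)) => bp.
by move: e0 e1; rewrite bp /=; case: (odd p); case: (b p.+1).
Qed.

(** This is twice [horizontal_sum] with [alternation_sum] inserted for the outer columns. Reaching
    the constant 4 takes one full edge in each of them and all four corners in [I]; for odd [p] the
    parity in [alternation_sum] forbids this. *)
Lemma gain_le n p I F : valid n p I F -> 0 < p -> p <= n.+1 ->
  4 * (\sum_(c < n.+1) \sum_(j < p) I c j) <=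
  2 * (n.+1 * p) + 4 - odd p + 4 * \sum_(c < n) \sum_(j < p) F c j.
Proof.
case: p => // p V _ pn.
have arith T D i0 i1 Q s0 s1 f0 f1 (x0 x1 y0 y1 : bool) :
    2 * T + D = n * p.+1 + i0 + i1 + 2 * Q ->
    2 * i0 + s0 = p + f0 + x0 + x1 -> 2 * i1 + s1 = p + f1 + y0 + y1 ->
    [/\ f0 <= 1 + D, f1 <= 1 + D & f0 + f1 <= 2 + D] ->
    4 * T <= 2 * (n.+1 * p.+1) + 4 - odd p.+1 + 4 * Q.
  by move=> h0 h1 h2 []; move: x0 x1 y0 y1 h0 h1 h2 => [] [] [] [] /=; lia.
exact: arith (horizontal_sum V) (alternation_sum p (I 0)) (alternation_sum p (I n))
  (full_edges_bounds V pn).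
Qed.

(** Equality in the count leaves no defect, makes the first column a block and puts the bottom
    vertices of both outer columns in [I]. *)
Lemma extremal_length n p I F : valid n p I F -> ~~ odd p -> 0 < p -> p <= n.+1 ->
  2 * (n.+1 * p) + 4 + 4 * (\sum_(c < n) \sum_(j < p) F c j) <=
  4 * \sum_(c < n.+1) \sum_(j < p) I c j ->
  exists k l, l < k /\ n = k * p.-1 + 2 * l.
Proof.
case: p => // p V ev _ pn ge.
have arith T D i0 i1 Q s0 s1 f0 f1 (x0 x1 y0 y1 : bool) :
    2 * T + D = n * p.+1 + i0 + i1 + 2 * Q ->
    2 * i0 + s0 = p + f0 + x0 + x1 -> 2 * i1 + s1 = p + f1 + y0 + y1 ->
    [/\ f0 <= 1 + D, f1 <= 1 + D & f0 + f1 <= 2 + D] ->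
    2 * (n.+1 * p.+1) + 4 + 4 * Q <= 4 * T ->
    [/\ D = 0, s0 = 0, f0 = 1, x0 & y0].
  by move=> h0 h1 h2 []; move: x0 x1 y0 y1 h0 h1 h2 => [] [] [] [] /=; split; lia.
have [D0 s0 f0 I00 In0] := arith _ _ _ _ _ _ _ _ _ _ _ _ _
  (horizontal_sum V) (alternation_sum p (I 0)) (alternation_sum p (I n))
  (full_edges_bounds V pn) ge.
have [a [oa ap B]] := one_full_edge I00 s0 f0.
apply: (block_length ev oa _ V _ _ In0); first by rewrite ltnS.
  move=> c j cn jp; move/eqP: D0; rewrite sum_nat_eq0 => /forallP /(_ (Ordinal cn)).
  by rewrite sum_nat_eq0 => /forallP /(_ (Ordinal jp)); rewrite /= eqb0.
by move=> j jp; apply: B.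
Qed.

(** * Bicliques of the grid and unit squares *)

Definition adjacent (x y x' y' : nat) :=
  (x == x') && ((y.+1 == y') || (y'.+1 == y)) ||
  (y == y') && ((x.+1 == x') || (x'.+1 == x)).

Definition in_square (x y x' y' : nat) := [&& x <= x', x' <= x.+1, y <= y' & y' <= y.+1].

Lemma diagonal_of_common_neighbors a1 a2 c1 c2 b1 b2 d1 d2 :
  adjacent a1 a2 b1 b2 -> adjacent a1 a2 d1 d2 ->
  adjacent c1 c2 b1 b2 -> adjacent c1 c2 d1 d2 ->
  ~ (a1 = c1 /\ a2 = c2) -> ~ (b1 = d1 /\ b2 = d2) ->
  ((a1.+1 == c1) || (c1.+1 == a1)) && ((a2.+1 == c2) || (c2.+1 == a2)).
Proof.
rewrite /adjacent => h1 h2 h3 h4 na nb.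
by case/orP: h1 => /andP [/eqP ? /orP [] /eqP ?];
  case/orP: h4 => /andP [/eqP ? /orP [] /eqP ?]; subst; lia.
Qed.

Lemma in_square_of_diagonal a1 a2 c1 c2 x y :
  ((a1.+1 == c1) || (c1.+1 == a1)) && ((a2.+1 == c2) || (c2.+1 == a2)) ->
  adjacent x y a1 a2 -> adjacent x y c1 c2 -> in_square (minn a1 c1) (minn a2 c2) x y.
Proof. by rewrite /adjacent /in_square; lia. Qed.

(** As neighbors of [a], the corners [b] and [d] are opposite, so their common neighbors are the
    other two corners. *)
Lemma in_square_of_corners f1 f2 a1 a2 b1 b2 d1 d2 x y :
  in_square f1 f2 a1 a2 -> in_square f1 f2 b1 b2 -> in_square f1 f2 d1 d2 ->
  ~ (b1 = d1 /\ b2 = d2) ->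
  adjacent x y b1 b2 -> adjacent x y d1 d2 ->
  adjacent a1 a2 b1 b2 -> adjacent a1 a2 d1 d2 -> in_square f1 f2 x y.
Proof. by rewrite /adjacent /in_square; lia. Qed.

(** The two columns of the square add up to [f1.*2.+1], so the subtraction gives the corner opposite
    to [u]; every side of a square meets one of two opposite corners. *)
Lemma opposite_corner_nat f1 f2 u1 u2 x1 x2 y1 y2 :
  in_square f1 f2 u1 u2 -> in_square f1 f2 x1 x2 -> in_square f1 f2 y1 y2 ->
  adjacent x1 x2 y1 y2 ->
  [\/ x1 = u1 /\ x2 = u2, y1 = u1 /\ y2 = u2,
      x1 = f1.*2.+1 - u1 /\ x2 = f2.*2.+1 - u2 | y1 = f1.*2.+1 - u1 /\ y2 = f2.*2.+1 - u2].
Proof.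
rewrite /adjacent /in_square => hu hx hy a.
have : [\/ (x1 == u1) && (x2 == u2), (y1 == u1) && (y2 == u2),
    (x1 == f1.*2.+1 - u1) && (x2 == f2.*2.+1 - u2) |
    (y1 == f1.*2.+1 - u1) && (y2 == f2.*2.+1 - u2)] by apply/or4P; lia.
by case=> /andP [/eqP ? /eqP ?]; [constructor 1 | constructor 2 | constructor 3 | constructor 4].
Qed.

Section Grid.
Variables p q : nat.
Implicit Types (u v w f : 'I_q * 'I_p) (S T A : {set 'I_q * 'I_p}).

Lemma grid_adjE u v : grid_adj u v = adjacent u.1 u.2 v.1 v.2.
Proof. by rewrite /grid_adj /adjacent; lia. Qed.

Lemma vertex_eq u v : u.1 = v.1 :> nat -> u.2 = v.2 :> nat -> u = v.
Proof. by case: u v => [a b] [c d] /= /val_inj -> /val_inj ->. Qed.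

Lemma vertex_neq u v : u != v -> ~ (u.1 = v.1 :> nat /\ u.2 = v.2 :> nat).
Proof. by move/eqP=> nuv [e1 e2]; apply: nuv; apply: vertex_eq. Qed.

Lemma vertexP x y : x < q -> y < p -> {v : 'I_q * 'I_p | v.1 = x :> nat & v.2 = y :> nat}.
Proof. by move=> xq yp; exists (Ordinal xq, Ordinal yp). Qed.

(* Unit squares are denoted by their lower left corner. *)
Definition is_square f := (f.1.+1 < q) && (f.2.+1 < p).
Definition in_sq f u := in_square f.1 f.2 u.1 u.2.

Definition covered S T u v :=
  [|| u \in S, v \in S | [exists f in T, in_sq f u && in_sq f v]].
Definition mixed_cover S T : Prop :=
  (forall f, f \in T -> is_square f) /\ (forall u v, grid_adj u v -> covered S T u v).

Lemma square_of_common_neighbors (a a' b b' : 'I_q * 'I_p) : a != a' -> b != b' ->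
  grid_adj a b -> grid_adj a b' -> grid_adj a' b -> grid_adj a' b' ->
  exists f, [/\ is_square f, in_sq f a, in_sq f a' &
    forall x, grid_adj x a -> grid_adj x a' -> in_sq f x].
Proof.
move=> /vertex_neq na /vertex_neq nb; rewrite !grid_adjE => h1 h2 h3 h4.
have d := diagonal_of_common_neighbors h1 h2 h3 h4 na nb.
have := ltn_ord a.1; have := ltn_ord a'.1; have := ltn_ord a.2; have := ltn_ord a'.2.
have [f f1 f2] := vertexP (leq_ltn_trans (geq_minl _ _) (ltn_ord a.1) : minn a.1 a'.1 < q)
  (leq_ltn_trans (geq_minl _ _) (ltn_ord a.2) : minn a.2 a'.2 < p).
move=> ? ? ? ?; exists f; rewrite /is_square /in_sq f1 f2.
split; [by lia | by rewrite /in_square; lia | by rewrite /in_square; lia |].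
by move=> x; rewrite !grid_adjE; apply: in_square_of_diagonal.
Qed.

(** A side with one vertex gives a star. Otherwise two vertices on each side span a unit square,
    which then contains all common neighbors. *)
Lemma biclique_shape (K : {set grid p q} * {set grid p q}) : is_biclique K ->
  (exists v, forall u w, biclique_edge K u w -> u = v \/ w = v) \/
  (exists2 f, is_square f & forall u w, biclique_edge K u w -> in_sq f u && in_sq f w).
Proof.
case: K => A B /and4P [] /= /set0Pn [a aA] /set0Pn [b bB] _ /forall_inP adjAB.
have adjP x y : x \in A -> y \in B -> grid_adj x y.
  by move=> xA yB; apply: (forall_inP (adjAB x xA)).
case: (boolP [forall x in A, x == a]) => [/forall_inP Aa | /forall_inPn [a' a'A na]].
  left; exists a => u w; rewrite /biclique_edge /=.
  by case/orP=> /andP [h1 h2]; [left | right]; apply/eqP; apply: Aa.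
case: (boolP [forall x in B, x == b]) => [/forall_inP Bb | /forall_inPn [b' b'B nb]].
  left; exists b => u w; rewrite /biclique_edge /=.
  by case/orP=> /andP [h1 h2]; [right | left]; apply/eqP; apply: Bb.
right; rewrite eq_sym in na; rewrite eq_sym in nb.
have [f [sf fa fa' fB]] := square_of_common_neighbors na nb (adjP _ _ aA bB)
  (adjP _ _ aA b'B) (adjP _ _ a'A bB) (adjP _ _ a'A b'B).
have inB x : x \in B -> in_sq f x.
  by move=> xB; apply: fB; rewrite grid_adj_sym; apply: adjP.
have inA x : x \in A -> in_sq f x.
  move=> xA; move: (adjP _ _ xA bB) (adjP _ _ xA b'B) (adjP _ _ aA bB) (adjP _ _ aA b'B).
  move: fa (inB _ bB) (inB _ b'B) (vertex_neq nb); rewrite !grid_adjE /in_sq.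
  exact: in_square_of_corners.
exists f => // u w; rewrite /biclique_edge /= => /orP [] /andP [h1 h2].
  by rewrite inA ?inB.
by rewrite inB ?inA.
Qed.

Lemma mixed_cover_of_bicliques (s : seq ({set grid p q} * {set grid p q})) :
  {in s, forall K, is_biclique K} -> exists S T,
  [/\ #|S| + #|T| <= size s, forall f, f \in T -> is_square f &
      forall K u v, K \in s -> biclique_edge K u v -> covered S T u v].
Proof.
elim: s => [|K s IH] bs.
  by exists set0, set0; split=> [|f|K u v //]; rewrite ?cards0 ?inE.
have [|S [T [card sq cov]]] := IH; first by move=> K' h; apply: bs; rewrite inE h orbT.
case: (biclique_shape (bs K (mem_head _ _))) => [[v Kv] | [f sf Kf]].
  exists (v |: S), T; split=> //.
    by rewrite cardsU1 /= -addnA -add1n; apply: leq_add; rewrite ?leq_b1.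
  move=> K' u w; rewrite inE /covered => /orP [/eqP -> /Kv [] -> | /cov h /h].
  - by rewrite setU11.
  - by rewrite setU11 orbT.
  - by rewrite /covered !inE => /or3P [] ->; rewrite ?orbT.
exists S, (f |: T); split.
- by rewrite cardsU1 addnCA /= -add1n; apply: leq_add; rewrite ?leq_b1.
- by move=> g; rewrite !inE => /orP [/eqP -> | /sq].
move=> K' u w; rewrite inE /covered => /orP [/eqP -> /Kf h | /cov h /h].
  by apply/or3P; constructor 3; apply/exists_inP; exists f; rewrite ?setU11.
rewrite /covered => /or3P [-> // | -> | /exists_inP [g gT gg]]; first by rewrite orbT.
by apply/or3P; constructor 3; apply/exists_inP; exists g => //; rewrite inE gT orbT.
Qed.

Lemma opposite_corner f u : is_square f -> in_sq f u ->
  exists w, forall x y, in_sq f x -> in_sq f y -> grid_adj x y ->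
    [|| x == u, y == u, x == w | y == w].
Proof.
move=> sf fu; have uq := ltn_ord u.1; have up' := ltn_ord u.2.
have [w w1 w2] : {w : 'I_q * 'I_p | w.1 = f.1.*2.+1 - u.1 :> nat & w.2 = f.2.*2.+1 - u.2 :> nat}.
  by apply: vertexP; move: sf fu; rewrite /is_square /in_sq /in_square; lia.
exists w => x y fx fy xy.
have eqv (z z' : 'I_q * 'I_p) : z.1 = z'.1 :> nat -> z.2 = z'.2 :> nat -> z == z'.
  by move=> e1 e2; apply/eqP; apply: vertex_eq.
have : [\/ x.1 = u.1 :> nat /\ x.2 = u.2 :> nat, y.1 = u.1 :> nat /\ y.2 = u.2 :> nat,
    x.1 = w.1 :> nat /\ x.2 = w.2 :> nat | y.1 = w.1 :> nat /\ y.2 = w.2 :> nat].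
  move: fu fx fy xy; rewrite grid_adjE w1 w2 /in_sq; exact: opposite_corner_nat.
by case=> - [e1 e2]; rewrite (eqv _ _ e1 e2) ?orbT.
Qed.

(* A square with a corner in [S] can be traded for its opposite corner. *)
Lemma full_squares S T : mixed_cover S T -> exists S' T',
  [/\ mixed_cover S' T', #|S'| + #|T'| <= #|S| + #|T| &
      forall f u, f \in T' -> in_sq f u -> u \notin S'].
Proof.
move: {2}#|T| (leqnn #|T|) => m; elim: m S T => [|m IH] S T Tm cov.
  move: Tm; rewrite leqn0 cards_eq0 => /eqP T0; exists S, T; split=> // f u.
  by rewrite T0 inE.
case: (boolP [exists f in T, [exists u in S, in_sq f u]]); last first.
  move/exists_inPn => none; exists S, T; split=> // f u fT fu.
  by apply: contra (none f fT) => uS; apply/exists_inP; exists u.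
case/exists_inP=> f fT /exists_inP [u uS fu]; have [sq edge] := cov.
have [w wP] := opposite_corner (sq f fT) fu.
have cT := cardsD1 f T; rewrite fT in cT.
have [||S' [T' [cov' card full]]] := IH (w |: S) (T :\ f); first by lia.
  split=> [g|x y xy]; first by rewrite !inE => /andP [_ /sq].
  case/or3P: (edge x y xy) => [xS|yS|/exists_inP [g gT gxy]].
  - by rewrite /covered !inE xS orbT.
  - by rewrite /covered !inE yS !orbT.
  case: (eqVneq g f) => [gf|gf].
    move: gxy; rewrite gf => /andP [fx fy].
    by case/or4P: (wP x y fx fy xy) => /eqP ->; rewrite /covered !inE ?uS ?eqxx ?orbT.
  by apply/or3P; constructor 3; apply/exists_inP; exists g => //; rewrite !inE gf.
exists S', T'; split=> //; apply: leq_trans card _.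
by rewrite cardsU1; case: (w \notin S); lia.
Qed.

(** Turns a set of vertices into a predicate on all pairs of naturals, [false] off the grid, as
    [valid] expects. *)
Definition mem_at A c j := [exists v in A, (v.1 == c :> nat) && (v.2 == j :> nat)].

Lemma mem_atP A v c j : v.1 = c :> nat -> v.2 = j :> nat -> mem_at A c j = (v \in A).
Proof.
move=> <- <-; apply/exists_inP/idP => [[u uA /andP [/eqP e1 /eqP e2]]|vA].
  by rewrite -(vertex_eq e1 e2).
by exists v; rewrite ?eqxx.
Qed.

Lemma mem_atE A c j : mem_at A c j -> exists v, [/\ v \in A, v.1 = c :> nat & v.2 = j :> nat].
Proof. by case/exists_inP=> v vA /andP [/eqP e1 /eqP e2]; exists v. Qed.

Lemma sum_mem_at A : \sum_(c < q) \sum_(j < p) mem_at A c j = #|A|.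
Proof.
rewrite pair_big /= -sum1_card [RHS]big_mkcond /=; apply: eq_bigr => v _.
by rewrite (@mem_atP A v) //; case: ifP.
Qed.
End Grid.

Lemma mixed_cover_valid p n (S T : {set 'I_n.+1 * 'I_p}) : mixed_cover S T ->
  (forall f u, f \in T -> in_sq f u -> u \notin S) ->
  valid n p (mem_at (~: S)) (mem_at T).
Proof.
move=> [sq edge] full.
have out c j : mem_at (~: S) c j ->
    exists v : 'I_n.+1 * 'I_p, [/\ v \notin S, v.1 = c :> nat & v.2 = j :> nat].
  by case/mem_atE=> v [vS e1 e2]; exists v; rewrite inE in vS.
have two u v : u \notin S -> v \notin S -> grid_adj u v ->
    exists f : 'I_n.+1 * 'I_p, [/\ f \in T, mem_at T f.1 f.2,
      in_square f.1 f.2 u.1 u.2 & in_square f.1 f.2 v.1 v.2].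
  move=> uS vS /edge; rewrite /covered (negbTE uS) (negbTE vS) /=.
  by case/exists_inP=> f fT /andP [fu fv]; exists f; rewrite (@mem_atP _ _ T f).
split=> c j.
- by case/mem_atE=> f [/sq]; rewrite /is_square => /andP [h1 h2] <- <-.
- case/mem_atE=> f [fT <- <-]; have := sq f fT; rewrite /is_square => /andP [h1 h2].
  have corner x y : in_square f.1 f.2 x y -> mem_at (~: S) x y.
    move=> fxy; have [||v v1 v2] := @vertexP p n.+1 x y.
    - by move: fxy; rewrite /in_square; lia.
    - by move: fxy; rewrite /in_square; lia.
    rewrite (mem_atP _ v1 v2) inE; apply: full fT _.
    by rewrite /in_sq v1 v2.
  by split; apply: corner; rewrite /in_square; lia.
- move=> cn jp /out [u [uS u1 u2]] /out [v [vS v1 v2]].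
  have [|f [fT fm fu fv]] := two u v uS vS; first by rewrite grid_adjE /adjacent; lia.
  move: fu fv; rewrite /in_square u1 u2 v1 v2 => fu fv.
  have e2 : f.2 = j :> nat by lia.
  have [e1|e1] : f.1 = c :> nat \/ f.1.+1 = c :> nat by lia.
    by rewrite -e1 -e2 fm.
  by rewrite -e1 -e2 /= fm orbT.
- move=> cn jp /out [u [uS u1 u2]] /out [v [vS v1 v2]].
  have [|f [fT fm fu fv]] := two u v uS vS; first by rewrite grid_adjE /adjacent; lia.
  move: fu fv; rewrite /in_square u1 u2 v1 v2 => fu fv.
  have e2 : f.1 = c :> nat by lia.
  have [e1|e1] : f.2 = j :> nat \/ f.2.+1 = j :> nat by lia.
    by rewrite -e1 -e2 fm.
  by rewrite -e1 -e2 /= fm orbT.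
Qed.

Lemma biclique_cover_bound p q (C : {set {set grid p q} * {set grid p q}}) :
  1 <= p -> p <= q -> is_biclique_cover C ->
  2 * (p * q) + odd p <= 4 * #|C| + 4 /\
  (~~ odd p -> 4 * #|C| + 4 <= 2 * (p * q) -> exceptional p q).
Proof.
case: q C => [|n] C p1 pq; first by lia.
case/andP=> /forall_inP bicl /forallP cov.
have [|S0 [T0 [card0 sq0 cov0]]] := @mixed_cover_of_bicliques p n.+1 (enum C).
  by move=> K; rewrite mem_enum; apply: bicl.
have mc : mixed_cover S0 T0.
  split=> // u v uv; have /implyP /(_ uv) /exists_inP [K KC] := forallP (cov u) v.
  by apply: cov0; rewrite mem_enum.
have [S [T [mcST card full]]] := full_squares mc.
have V := mixed_cover_valid mcST full.
have cS : \sum_(c < n.+1) \sum_(j < p) mem_at (~: S) c j + #|S| = n.+1 * p.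
  by rewrite sum_mem_at addnC cardsC card_prod !card_ord.
(* No square starts in the last column, so summing over the strips misses none. *)
have cT : \sum_(c < n) \sum_(j < p) mem_at T c j = #|T|.
  rewrite -(sum_mem_at T) big_ord_recr /= [X in _ = _ + X]big1 ?addn0 // => j _.
  by case E: (mem_at T n j) => //; have [dom _ _ _] := V; have [] := dom _ _ E; rewrite ltnn.
have {card0}card : #|S| + #|T| <= #|C| by have := leq_trans card card0; rewrite -cardE.
rewrite (mulnC p); split.
  have := gain_le V p1 pq; rewrite cT.
  have arith x s t m N : s + t <= m -> x + s = N -> 4 * x <= 2 * N + 4 - odd p + 4 * t ->
      2 * N + odd p <= 4 * m + 4.
    by case: (odd p) => /=; lia.
  exact: arith card cS.
move=> ev small; split=> //; rewrite !subn1 /=.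
apply: (extremal_length V ev p1 pq); rewrite cT.
have arith x s t m N : s + t <= m -> x + s = N -> 4 * m + 4 <= 2 * N ->
    2 * N + 4 + 4 * t <= 4 * x by lia.
exact: arith card cS small.
Qed.

(** * Constructions *)

Definition low_edge n (h : nat -> nat) c := 0 < h c ->
  c < n /\ h c = (h c.+1).+1 \/ 0 < c /\ h c = (h c.-1).+1.
Definition high_edge p n (h : nat -> nat) c := (h c).+1 < p ->
  c < n /\ h c.+1 = (h c).+1 \/ 0 < c /\ h c.-1 = (h c).+1.

(* [h c] is the row of the path in column [c]; the path may only rest at a
   vertex of odd coordinate sum, and both vertical edges of its other vertices
   lie in squares that it crosses. *)
Definition zigzag p n (h : nat -> nat) :=
  [/\ forall c, c <= n -> h c < p,
      forall c, c < n -> h c.+1 = h c \/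
        ~~ odd (c + h c) /\ (h c.+1 = (h c).+1 \/ h c = (h c.+1).+1)
    & forall c, c < n -> ~~ odd (c + h c) -> low_edge n h c /\ high_edge p n h c].

(** In the paths built below, only the middle column of a two-column rest has odd sum, so each rest
    counts once. *)
Definition rests n (h : nat -> nat) := \sum_(c < n.+1) odd (c + h c).
Definition moves n (h : nat -> nat) := \sum_(c < n) (h c != h c.+1).

(* A zigzag up to column [n] with [l] rests and [m] moves, ending in row [j];
   [lo] and [hi] record that the last move came from below or from above. *)
Definition reach p n j l m (lo hi : bool) := exists h : nat -> nat,
  [/\ zigzag p n h, h n = j, lo -> 0 < n /\ j = (h n.-1).+1,
      hi -> 0 < n /\ h n.-1 = j.+1 & rests n h = l /\ moves n h = m].

(** The last hypothesis settles the vertical edges at the old end [(n, j)]: each is absent, or in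
    the square of the previous move, or in that of the new one. *)
Lemma reach_step p n j l m lo hi j' : reach p n j l m lo hi -> j' < p ->
  j' = j \/ ~~ odd (n + j) /\ (j' = j.+1 \/ j = j'.+1) ->
  (~~ odd (n + j) -> (lo \/ j = 0 \/ j = j'.+1) /\ (hi \/ p <= j.+1 \/ j' = j.+1)) ->
  reach p n.+1 j' (l + odd (n.+1 + j')) (m + (j != j')) (j' == j.+1) (j == j'.+1).
Proof.
case=> h [[bound step edges] hn loP hiP [<- <-]] j'p mv cl.
pose g c := if c <= n then h c else j'.
have gE c : c <= n -> g c = h c by rewrite /g => ->.
have gn1 : g n.+1 = j' by rewrite /g ltnn.
exists g; split=> //=.
- split=> c.
  + by case: (leqP c n) => [cn _|lt _]; [rewrite gE // bound | rewrite /g [c <= n]leqNgt lt].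
  + rewrite ltnS leq_eqVlt => /orP [/eqP -> | cn].
      by rewrite gn1 gE // hn.
    by rewrite !gE //; [exact: step | exact: ltnW].
  + rewrite ltnS leq_eqVlt => /orP [/eqP -> | cn].
      rewrite /low_edge /high_edge gn1 !gE ?leq_pred // hn => ev.
      have [c1 c2] := cl ev; split=> [pos | lt].
        case: c1 => [/loP | [e | e]]; [by right | by rewrite e in pos | by left].
      case: c2 => [/hiP | [e | e]]; [by right | by rewrite ltnNge e in lt | by left].
    rewrite /low_edge /high_edge (gE c.+1 cn) (gE c (ltnW cn)).
    rewrite (gE c.-1 (leq_trans (leq_pred c) (ltnW cn))).
    move=> ev; have [e1 e2] := edges c cn ev.
    by split=> [/e1 | /e2] [] [h1 h2]; [left | right | left | right]; split=> //; apply: ltnW.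
- by move=> /eqP ->; rewrite gE // hn.
- by move=> /eqP e; rewrite gE // hn.
- split; rewrite /rests /moves big_ord_recr /= ?gn1.
    by congr (_ + _); apply: eq_bigr => c _; rewrite gE // -ltnS.
  rewrite gE // hn; congr (_ + _); apply: eq_bigr => c _.
  by rewrite !gE // ltnW.
Qed.

Lemma reach_up p n j l m lo hi i : reach p n j l m lo hi -> ~~ odd (n + j) ->
  lo \/ j = 0 -> j + i.+1 < p ->
  reach p (n + i.+1) (j + i.+1) l (m + i.+1) true false.
Proof.
move=> r ev s; elim: i => [|i IH] jp.
  rewrite !addn1 in jp *.
  have := reach_step r jp; rewrite (_ : j != j.+1); last by lia.
  rewrite eqxx (_ : j == j.+2 = false); last by lia.
  rewrite (_ : odd (n.+1 + j.+1) = false) ?addn0 ?addn1; last by lia.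
  by apply; [right; split=> //; left | split; [case: s; [left | right; left] | right; right]].
have {}r := IH ltac:(lia).
rewrite !(addnS _ i.+1); have := reach_step (j' := (j + i.+1).+1) r.
rewrite (_ : j + i.+1 != (j + i.+1).+1); last by lia.
rewrite eqxx (_ : j + i.+1 == (j + i.+1).+2 = false); last by lia.
rewrite (_ : odd ((n + i.+1).+1 + _) = false) ?addn0 ?addn1; last by lia.
apply; first by lia.
- by right; split; [lia | left].
- by split; [left | right; right].
Qed.

Lemma reach_down p n j l m lo hi i : reach p n j l m lo hi -> ~~ odd (n + j) ->
  hi \/ p <= j.+1 -> i < j ->
  reach p (n + i.+1) (j - i.+1) l (m + i.+1) false true.
Proof.
move=> r ev s; have jp : j < p by case: r => h [[b _ _] <- _ _ _]; exact: b.
elim: i => [|i IH] ij.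
  rewrite !addn1 subn1; have := reach_step (j' := j.-1) r; rewrite prednK // eqxx.
  rewrite (_ : j != j.-1); last by lia.
  rewrite (_ : j.-1 == j.+1 = false); last by lia.
  rewrite (_ : odd (n.+1 + j.-1) = false) ?addn0 ?addn1; last by lia.
  apply; first by lia.
  - by right; split=> //; right.
  - by split; [right; right | case: s; [left | right; left]].
have {}r := IH (ltnW ij).
rewrite !addnS; have := reach_step (j' := j - i.+2) r.
rewrite (_ : j - i.+1 = (j - i.+2).+1) in r *; last by lia.
rewrite (_ : (j - i.+2).+1 != j - i.+2); last by lia.
rewrite eqxx (_ : j - i.+2 == (j - i.+2).+2 = false); last by lia.
rewrite (_ : odd ((n + i.+1).+1 + _) = false) ?addn0 ?addn1 -?addnS; last by lia.
rewrite !addnS; apply; first by lia.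
- by right; split; [lia | right].
- by split; [right; right | left].
Qed.

(** For even [p] this vertex has even sum, so the path may leave it; [p.-1] moves lead to the
    opposite border row. *)
Definition corner p n := if odd n then p.-1 else 0.
Definition at_corner p n l m := reach p n (corner p n) l m (odd n) (~~ odd n).

Lemma corner_traverse p n l m lo hi : ~~ odd p -> 0 < p ->
  reach p n (corner p n) l m lo hi -> at_corner p (n + p.-1) l (m + p.-1).
Proof.
move=> evp p0; rewrite /at_corner /corner => r.
have [i pE] : exists i, p.-1 = i.+1 by exists p.-2; lia.
move: r; case od: (odd n) => r.
  have := reach_down (i := i) r; rewrite -pE subnn (_ : odd (n + p.-1) = false); last by lia.
  by apply; lia.
have := reach_up (i := i) r; rewrite -pE add0n (_ : odd (n + p.-1) = true); last by lia.
by apply; [lia | right | lia].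
Qed.

(** A rest needs the vertical edge at the corner to be covered by the arriving move, hence
    [at_corner]; afterwards both flags are lost. *)
Lemma corner_wait p n l m : ~~ odd p -> 0 < p -> at_corner p n l m ->
  reach p n.+2 (corner p n.+2) l.+1 m false false.
Proof.
move=> evp p0; rewrite /at_corner /corner /= negbK.
set j := if odd n then _ else _ => r.
have jE : ~~ odd (n + j) by rewrite /j; case: ifP; lia.
have jp : j < p by rewrite /j; case: ifP; lia.
have := reach_step r jp (or_introl erefl).
rewrite eqxx !addn0 (_ : j == j.+1 = false); last by lia.
rewrite (_ : odd (n.+1 + j)) ?addn1; last by lia.
move=> H; have {H}r1 : reach p n.+1 j l.+1 m false false.
  apply: H => _; rewrite /j; case: ifP => _; split; [by left | right; left; lia | by right; left | by left].
have := reach_step r1 jp (or_introl erefl).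
rewrite eqxx !addn0 (_ : j == j.+1 = false); last by lia.
rewrite (_ : odd (n.+2 + j) = false) ?addn0; last by lia.
by apply; lia.
Qed.

(** A rest may precede every traversal but the first, hence [l < k]. *)
Lemma zigzag_exists p k l : ~~ odd p -> 0 < p -> l < k ->
  at_corner p (k * p.-1 + 2 * l) l (k * p.-1).
Proof.
move=> evp p0; elim: k l => // k IH [|l] lk.
  rewrite muln0 addn0 mulSn addnC.
  case: k IH {lk} => [|k] IH.
    apply: (corner_traverse (lo := false) (hi := false)) => //.
    exists (fun=> 0); split=> //.
    by rewrite /rests /moves mul0n big_ord_recr !big_ord0.
  by apply: corner_traverse => //; have := IH 0 isT; rewrite muln0 addn0; exact: id.
have := corner_traverse evp p0 (corner_wait evp p0 (IH l lk)).
rewrite (mulSnr k) (_ : (k * p.-1 + 2 * l).+2 + p.-1 = k * p.-1 + p.-1 + 2 * l.+1) //.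
by lia.
Qed.

(** * Biclique covers from centers and squares *)

Section Covers.
Variables p q : nat.
Implicit Types (u v w f : 'I_q * 'I_p) (S T : {set 'I_q * 'I_p}).

Definition star v : {set grid p q} * {set grid p q} :=
  ([set v], [set w | grid_adj v w]).
Definition square f : {set grid p q} * {set grid p q} :=
  ([set u | in_sq f u & ~~ odd (u.1 + u.2 + (f.1 + f.2))],
   [set u | in_sq f u & odd (u.1 + u.2 + (f.1 + f.2))]).

Lemma star_biclique v w : grid_adj v w -> is_biclique (star v).
Proof.
move=> vw; apply/and4P; split => /=.
- by apply/set0Pn; exists v; rewrite set11.
- by apply/set0Pn; exists w; rewrite inE.
- by rewrite disjoints1 inE grid_adj_irrefl.
- by apply/forall_inP => x /set1P ->; apply/forall_inP => y; rewrite inE.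
Qed.

Lemma square_biclique f : is_square f -> is_biclique (square f).
Proof.
move=> /andP [f1 f2]; apply/and4P; split => /=.
- by apply/set0Pn; exists f; rewrite inE /in_sq /in_square; lia.
- have [w w1 w2] := vertexP f1 (ltn_ord f.2).
  by apply/set0Pn; exists w; rewrite inE /in_sq /in_square w1 w2; lia.
- rewrite -setI_eq0; apply/eqP/setP => x; rewrite !inE.
  by case: (odd _); rewrite ?andbF.
- apply/forall_inP => x; rewrite inE => hx; apply/forall_inP => y; rewrite inE => hy.
  by move: hx hy; rewrite grid_adjE /adjacent /in_sq /in_square; lia.
Qed.

Lemma bc_le_mixed S T : mixed_cover S T ->
  (forall v, v \in S -> exists w, grid_adj v w) -> bc (grid p q) <= #|S| + #|T|.
Proof.
move=> [sq edge] nbr; pose C := (star @: S) :|: (square @: T).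
have cov : is_biclique_cover C.
  apply/andP; split.
    apply/forall_inP => K; rewrite inE => /orP [] /imsetP [x xin ->].
      by have [w /star_biclique] := nbr x xin.
    exact: square_biclique (sq x xin).
  apply/forallP => u; apply/forallP => v; apply/implyP => uv; apply/exists_inP.
  have {}uv : grid_adj u v := uv.
  have vu : grid_adj v u by rewrite grid_adj_sym.
  case/or3P: (edge u v uv) => [uS | vS | /exists_inP [f fT /andP [fu fv]]].
  - exists (star u); first by rewrite inE imset_f.
    by rewrite /biclique_edge !inE eqxx uv.
  - exists (star v); first by rewrite inE imset_f.
    by rewrite /biclique_edge !inE eqxx vu orbT.
  exists (square f); first by rewrite inE (imset_f square fT) orbT.
  move: uv; rewrite /biclique_edge !inE fu fv /= grid_adjE /adjacent.
  by move: fu fv; rewrite /in_sq /in_square; lia.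
apply: leq_trans (proj2 (bcP (grid p q)) C cov) _.
apply: leq_trans (leq_card_setU _ _) _.
by apply: leq_add; apply: leq_imset_card.
Qed.

Lemma odd_column (c : nat) : \sum_(j < p) odd (c + j) = (p + odd c)./2.
Proof.
elim: p => [|m IH]; first by rewrite big_ord0; case: odd.
rewrite big_ord_recr /= IH oddD; have := odd_double_half m.
by case: (odd c); case: (odd m) => /=; lia.
Qed.

Lemma odd_count : \sum_(c < q) \sum_(j < p) odd (c + j) = (p * q)./2.
Proof.
elim: q => [|m IH]; first by rewrite big_ord0 muln0.
rewrite big_ord_recr /= IH odd_column mulnS.
have := oddM p m; have := odd_double_half p; have := odd_double_half (p * m).
by move: (p * m) => N; case: (odd p); case: (odd m) => /= hN hp oN; rewrite oN /= in hN; lia.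
Qed.

Lemma card_grid_set (P : nat -> nat -> bool) :
  #|[set v : 'I_q * 'I_p | P v.1 v.2]| = \sum_(c < q) \sum_(j < p) P c j.
Proof.
rewrite pair_big /= -sum1_card big_mkcond /=.
by apply: eq_bigr => v _; rewrite inE; case: ifP.
Qed.

Lemma grid_neighbor v : 1 < p * q -> exists w, grid_adj v w.
Proof.
move=> pq; have h1 := ltn_ord v.1; have h2 := ltn_ord v.2.
have [q1|q1] := ltnP 1 q.
  have [w w1 w2] : {w : 'I_q * 'I_p |
      w.1 = (if 0 < v.1 then v.1.-1 else 1) :> nat & w.2 = v.2 :> nat}.
    by apply: vertexP => //; case: ifP => //; lia.
  by exists w; rewrite grid_adjE /adjacent w1 w2; case: ifP; lia.
have [w w1 w2] : {w : 'I_q * 'I_p |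
    w.1 = v.1 :> nat & w.2 = (if 0 < v.2 then v.2.-1 else 1) :> nat}.
  by apply: vertexP => //; case: ifP => //; have := leq_mul (leqnn p) q1; lia.
by exists w; rewrite grid_adjE /adjacent w1 w2; case: ifP; lia.
Qed.

(** Stars at the odd class of the checkerboard, which is never the larger one, cover every edge. *)
Lemma bc_le_half : bc (grid p q) <= (p * q)./2.
Proof.
pose S := [set v : 'I_q * 'I_p | odd (v.1 + v.2)].
rewrite -odd_count -(card_grid_set (fun c j => odd (c + j))) -/S -[leqRHS]addn0.
rewrite -(cards0 ('I_q * 'I_p)%type); apply: bc_le_mixed.
  split=> [f | u v]; first by rewrite inE.
  by rewrite /covered !inE grid_adjE /adjacent; lia.
move=> v; rewrite inE => ov; apply: grid_neighbor.
have h1 := ltn_ord v.1; have h2 := ltn_ord v.2.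
have [q1|q1] : 1 < q \/ 1 < p by lia.
  by have := leq_mul (_ : 1 <= p) q1; lia.
by have := leq_mul q1 (_ : 1 <= q); lia.
Qed.
End Covers.

(** * The cover along a zigzag path *)

Section Zigzag.
Variables (p n : nat) (h : nat -> nat).
Hypothesis hzig : zigzag p n h.

(** The even class of the checkerboard, changed along the path: path vertices of even sum are
    dropped, those of odd sum added. *)
Definition center c j := (j == h c) == odd (c + j).
Definition crossed c j :=
  (c < n) && ((h c == j) && (h c.+1 == j.+1) || (h c == j.+1) && (h c.+1 == j)).

(** The first hypothesis treats the last column, where [zigzag] does not constrain the vertical
    edges. *)
Lemma vertical_covered c j :
  (~~ odd (n + h n) -> low_edge n h n /\ high_edge p n h n) -> c <= n -> j.+1 < p ->
  [|| center c j, center c j.+1, crossed c j | (0 < c) && crossed c.-1 j].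
Proof.
move=> hend cn jp; have [_ _ edges] := hzig.
have cl : ~~ odd (c + h c) -> low_edge n h c /\ high_edge p n h c.
  by move: cn; rewrite leq_eqVlt => /orP [/eqP -> | /edges].
rewrite /center; case: (eqVneq j (h c)) => [jE|jh].
  rewrite (_ : j.+1 == h c = false); last by lia.
  case od: (odd (c + j)) => //=; have [|_ hi] := cl; first by rewrite -jE od.
  have hp : (h c).+1 < p by rewrite -jE.
  case: (hi hp) => [[c1 e]|[c0 e]].
    by rewrite /crossed c1 -jE e -jE !eqxx !orbT.
  apply/orP; right; apply/orP; right; rewrite c0 /crossed prednK // e -jE !eqxx.
  by rewrite cn orbT.
case: (eqVneq j.+1 (h c)) => [jE|jh1]; last by rewrite addnS /=; case: (odd (c + j)).
case od: (odd (c + j.+1)); rewrite ?orbT //; have [|lo _] := cl; first by rewrite -jE od.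
have h0 : 0 < h c by rewrite -jE.
case: (lo h0) => [[c1 e]|[c0 e]].
  by rewrite /crossed c1 -jE; move: e; rewrite -jE => -[<-]; rewrite !eqxx !orbT.
do 3 (apply/orP; right); rewrite c0 /crossed prednK // -jE.
move: e; rewrite -jE => -[<-]; rewrite !eqxx.
by rewrite cn.
Qed.

(** The end of even sum is a center unless it is on the path; then the path crosses a square at this
    edge, or stays in the row and makes the other end a center. *)
Lemma horizontal_covered c j : c < n -> j < p ->
  [|| center c j, center c.+1 j, crossed c j | (0 < j) && crossed c j.-1].
Proof.
move=> cn jp; have [_ step _] := hzig; rewrite /center /crossed cn /=.
by case: (step c cn) => [-> | [ev [e|e]]]; lia.
Qed.

Definition zigzag_centers := [set v : 'I_n.+1 * 'I_p | center v.1 v.2].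
Definition zigzag_squares := [set f : 'I_n.+1 * 'I_p | crossed f.1 f.2].

Lemma zigzag_cover :
  (~~ odd (n + h n) -> low_edge n h n /\ high_edge p n h n) ->
  mixed_cover zigzag_centers zigzag_squares.
Proof.
move=> hend.
have [bound _ _] := hzig; split=> [f|].
  rewrite inE /is_square /crossed => /andP [c1 fh]; rewrite ltnS c1 /=.
  by have := bound _ (ltnW c1); have := bound _ c1; lia.
have sq (u v : 'I_n.+1 * 'I_p) c j : c < n.+1 -> j < p -> crossed c j ->
    in_square c j u.1 u.2 -> in_square c j v.1 v.2 ->
    covered zigzag_centers zigzag_squares u v.
  move=> cn jp cr; have [f f1 f2] := vertexP cn jp => iu iv.
  by apply/or3P; constructor 3; apply/exists_inP; exists f; rewrite ?inE /in_sq f1 f2 // iu iv.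
have one (u v : 'I_n.+1 * 'I_p) :
    u.1 = v.1 :> nat /\ v.2 = u.2.+1 :> nat \/ u.2 = v.2 :> nat /\ v.1 = u.1.+1 :> nat ->
    covered zigzag_centers zigzag_squares u v.
  have u1 := ltn_ord u.1; have u2 := ltn_ord u.2; have v1 := ltn_ord v.1; have v2 := ltn_ord v.2.
  case=> [[e1 e2]|[e1 e2]].
    have jp : (u.2.+1 < p)%N by rewrite -e2.
    case/or4P: (vertical_covered hend u1 jp) => [h1|h1|h1|/andP [c0 h1]].
    - by rewrite /covered !inE h1.
    - by rewrite /covered !inE -e1 e2 h1 orbT.
    - by apply: sq h1 _ _ => //; rewrite /in_square; lia.
    - by apply: sq h1 _ _ => //; rewrite /in_square; lia.
  have jn : (u.1 < n)%N by rewrite -ltnS -e2.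
  case/or4P: (horizontal_covered jn u2) => [h1|h1|h1|/andP [c0 h1]].
  - by rewrite /covered !inE h1.
  - by rewrite /covered !inE -e1 e2 h1 orbT.
  - by apply: sq h1 _ _ => //; rewrite /in_square; lia.
  - by apply: sq h1 _ _; [| lia | |]; rewrite /in_square; lia.
have sym (u v : 'I_n.+1 * 'I_p) : covered zigzag_centers zigzag_squares u v ->
    covered zigzag_centers zigzag_squares v u.
  rewrite /covered => /or3P [-> | -> | /exists_inP [f fT /andP [fu fv]]]; rewrite ?orbT //.
  by apply/or3P; constructor 3; apply/exists_inP; exists f; rewrite ?fu ?fv.
move=> u v; rewrite grid_adjE /adjacent.
case/orP=> /andP [/eqP e1 /orP [/eqP e2|/eqP e2]].
- by apply: one; left.
- by apply/sym/one; left.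
- by apply: one; right.
- by apply/sym/one; right.
Qed.

Lemma sum_eq_ord m i : i < m -> \sum_(j < m) (j == i :> nat) = 1.
Proof.
move=> im; rewrite (bigD1 (Ordinal im)) //= eqxx big1 // => j.
by rewrite -val_eqE /= => /negbTE ->.
Qed.

(** A column has [p./2 - 1] centers if its path vertex has even sum and [p./2 + 1] otherwise. *)
Lemma card_zigzag_centers : ~~ odd p ->
  #|zigzag_centers| + n.+1 = n.+1 * p./2 + 2 * rests n h.
Proof.
move=> ev; have [bound _ _] := hzig.
have col c : c < n.+1 -> \sum_(j < p) center c j + 1 = p./2 + 2 * odd (c + h c).
  move=> cn; have hp : h c < p by exact: bound.
  rewrite -{1}(sum_eq_ord hp) -big_split /=.
  rewrite (eq_bigr (fun j : 'I_p => odd (c.+1 + j) + 2 * odd (c + h c) * (j == h c :> nat))).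
    rewrite big_split (odd_column p c.+1) -big_distrr /= (sum_eq_ord hp) muln1; congr (_ + _).
    by have := odd_double_half p; rewrite (negbTE ev) /=; case: (odd c) => /=; lia.
  move=> j _; rewrite /center; case: (eqVneq (j : nat) (h c)) => [->|_] /=.
    by case: (odd (c + h c)).
  by case: (odd (c + j)); rewrite muln0.
rewrite /zigzag_centers (card_grid_set _ _ center) /rests.
elim: (n.+1) col => [|m IH] col; first by rewrite !big_ord0.
have := col m (ltnSn m); have := IH (fun c cm => col c (ltnW cm)).
by rewrite !big_ord_recr /= mulSn; lia.
Qed.

Lemma card_zigzag_squares : #|zigzag_squares| = moves n h.
Proof.
have [bound step _] := hzig.
rewrite /zigzag_squares (card_grid_set _ _ crossed) big_ord_recr /=.
rewrite [X in _ + X]big1 ?addn0 => [|j _]; last by rewrite /crossed ltnn.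
apply: eq_bigr => c _; have cn := ltn_ord c; rewrite /crossed cn /=.
case: (step c cn) => [e | [_ [e|e]]].
- by rewrite e eqxx big1 // => j _; lia.
- rewrite (_ : h c != h c.+1); last by lia.
  rewrite /= -(sum_eq_ord (bound _ (ltnW cn))); apply: eq_bigr => j _.
  by rewrite e; congr nat_of_bool; lia.
rewrite (_ : h c != h c.+1); last by lia.
rewrite /= -(sum_eq_ord (bound _ cn)); apply: eq_bigr => j _.
by rewrite e; congr nat_of_bool; lia.
Qed.
End Zigzag.

Lemma bc_le_exceptional p q : 1 <= p -> p <= q -> exceptional p q ->
  bc (grid p q) <= (p * q) %/ 2 - 1.
Proof.
case: q => [|n] p1 pn; first by lia.
rewrite /exceptional !subn1 /= => -[ev [k [l [lk nE]]]].
have := zigzag_exists ev p1 lk; rewrite -nE => -[h [hp hn lo hi [R M]]].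
(* The path ends in a corner: one vertical edge is absent, the other lies in the square of the last
   move. *)
have hend : ~~ odd (n + h n) -> low_edge n h n /\ high_edge p n h n.
  rewrite hn /low_edge /high_edge hn => _.
  move: lo hi; rewrite /corner; case: (odd n) => /= lo hi; split=> //.
  - by move=> _; right; exact: lo.
  - by lia.
  - by move=> _; right; exact: hi.
apply: leq_trans (bc_le_mixed (zigzag_cover hp hend) _) _.
  move=> v _; apply: grid_neighbor; have : 1 < p by case: (p) p1 ev => [|[]].
  by move=> p2; have := leq_mul p2 (isT : 1 <= n.+1); lia.
rewrite card_zigzag_squares // M.
have := card_zigzag_centers hp ev; rewrite R.
have -> : (p * n.+1) %/ 2 = n.+1 * p./2.
  have := odd_double_half p; rewrite (negbTE ev) add0n => {1}<-.
  by rewrite -muln2 mulnAC mulnK // mulnC.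
(* With [x] centers and [a] squares, the relation [n = a + 2 * l] cancels the rests and leaves
   [b - 1] bicliques. *)
have arith a b x : n = a + 2 * l -> x + n.+1 = b + 2 * l -> x + a <= b.-1 by lia.
exact: arith nE.
Qed.

Theorem theorem1p1 (p q : nat) (hp : 1 <= p) (hpq : p <= q) :
  (exceptional p q -> bc (grid p q) = (p * q) %/ 2 - 1) /\
  (~ exceptional p q -> bc (grid p q) = (p * q) %/ 2).
Proof.
have [[C cov cardC] _] := bcP (grid p q).
have [] := biclique_cover_bound hp hpq cov; rewrite cardC => lb ext.
have ub := bc_le_half p q.
have odd_pq : odd (p * q) -> odd p by rewrite oddM => /andP [].
split=> [ex | nex].
  apply/eqP; rewrite eqn_leq bc_le_exceptional //= divn2.
  by case: ex => ev _; move: lb ev; clear; move: (p * q) => N; lia.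
apply/eqP; rewrite eqn_leq divn2 ub /=.
(* For odd [p] the bound [(2 * (p * q) - 3) / 4], rounded up, is already the half of [p * q],
   rounded down. *)
case ev: (odd p) lb ext => /= lb ext.
  by move: lb; clear; move: (p * q) (bc _) => N b; lia.
case: (leqP (4 * bc (grid p q) + 4) (2 * (p * q))) => [small|].
  by case: nex; apply: ext.
move: odd_pq; rewrite ev; clear; move: (p * q) (bc _) => N b.
by move=> oN gt; have := odd_double_half N; case: (odd N) oN => [/(_ isT) //|_] /=; lia.
Qed.
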